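(* Let $f:[0,1]^d\to[-1,1]$ be Lipschitz continuous with Lipschitz constant $\ell$, i.e. $|f(\bm{x})-f(\bm{y})|\le \ell\|\bm{x}-\bm{y}\|_\infty$ for all $\bm{x},\bm{y}\in[0,1]^d$. For any $\varepsilon>0$ and $n\in\mathbb{N}$ there exists a PQC $W_b(\bm{x})$ such that $f_{W_b}(\bm{x}):=\langle 0|W_b^\dagger(\bm{x})Z^{(0)}W_b(\bm{x})|0\rangle$ satisfies $$|f(\bm{x})-f_{W_b}(\bm{x})|\le \varepsilon+2\Bigl(\bigl(1+\tfrac{\ell^2}{n\varepsilon^2}\bigr)^d-1\Bigr)\le \varepsilon+d2^d\frac{\ell^2}{n\varepsilon^2}$$ for all $\bm{x}\in[0,1]^d$. The width of the PQC is $O(d\log n)$, its depth is $O(dn^d\log n)$, and its number of parameters is $O(dn^d)$.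
   Context: $Z^{(0)}$ is the Pauli $Z$ observable on the first qubit and $|0\rangle$ the all-zeros state. A parameterized quantum circuit (PQC) with input $\bm{x}=(x_1,\dots,x_d)$ is a quantum circuit built from CNOT gates, Hadamard gates and single-qubit gates, where the single-qubit gates are either Pauli rotations $R_X(\theta)=e^{-i\theta X/2}$, $R_Y(\theta)$, $R_Z(\theta)=e^{-i\theta Z/2}$ with trainable real angles not depending on $\bm{x}$, or data-encoding gates $S(x_j)=e^{i\arccos(x_j)X}=\begin{pmatrix} x_j & i\sqrt{1-x_j^2}\\ i\sqrt{1-x_j^2} & x_j\end{pmatrix}$ for a coordinate $x_j\in[-1,1]$. Width = number of qubits, depth = circuit depth, number of parameters = number of trainable angles. Asymptotic bounds hold with absolute constants.
   Formalization: The chained inequality is stated as two separate upper bounds on the error, since the middle inequality fails for large ℓ²/(nε²) (e.g. d=2, ℓ=n=1, ε=1/2); d,n ≥ 1 and log n is read as ⌊log₂ n⌋+1. *)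

(* Defs.v *)
From mathcomp Require Import all_boot all_order all_algebra.
From mathcomp Require Import reals trigo.
From mathcomp Require Import complex.
Set Implicit Arguments. Unset Strict Implicit. Unset Printing Implicit Defensive.
Import Order.TTheory GRing.Theory Num.Theory.
Local Open Scope ring_scope.
Local Open Scope complex_scope.

(* Qubit k of basis index b (b < 2^w) is the k-th binary digit of b;
   qubit 0 ("the first qubit") is the least significant bit. *)
Definition qbit (k b : nat) : bool := odd (b %/ 2 ^ k).

Definition qflip (k b : nat) : nat := if qbit k b then (b - 2 ^ k)%N else (b + 2 ^ k)%N.

Inductive gate (R : Type) (w d : nat) : Type :=
| G_CNOT (c t : 'I_w) of c != t
| G_H (q : 'I_w)
| G_RX (q : 'I_w) (theta : R)
| G_RY (q : 'I_w) (theta : R)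
| G_RZ (q : 'I_w) (theta : R)
| G_S (q : 'I_w) (j : 'I_d).

Section Semantics.
Variable R : realType.
Local Notation C := R[i].

(* 2x2 matrices as functions bool -> bool -> C : u a b = <a|U|b> *)
Definition rx_u (th : R) (a b : bool) : C :=
  if a == b then Complex (cos (th / 2)) 0 else Complex 0 (- sin (th / 2)).
Definition ry_u (th : R) (a b : bool) : C :=
  if a == b then Complex (cos (th / 2)) 0
  else if a then Complex (sin (th / 2)) 0 else Complex (- sin (th / 2)) 0.
Definition rz_u (th : R) (a b : bool) : C :=
  if a == b then
    (if a then Complex (cos (th / 2)) (sin (th / 2))
          else Complex (cos (th / 2)) (- sin (th / 2)))
  else 0.
Definition h_u (a b : bool) : C :=
  Complex ((if a && b then -1 else 1) / Num.sqrt 2) 0.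
(* S(x) = [[x, i sqrt(1-x^2)], [i sqrt(1-x^2), x]] = exp(i arccos(x) X) *)
Definition s_u (x : R) (a b : bool) : C :=
  if a == b then Complex x 0 else Complex 0 (Num.sqrt (1 - x ^+ 2)).

Definition embed1 (w : nat) (q : 'I_w) (u : bool -> bool -> C) : 'M[C]_(2 ^ w) :=
  \matrix_(i, j)
    if [forall k : 'I_w, (k != q) ==> (qbit k i == qbit k j)]
    then u (qbit q i) (qbit q j) else 0.

Definition cnot_mx (w : nat) (c t : 'I_w) : 'M[C]_(2 ^ w) :=
  \matrix_(i, j)
    if qbit c j then (if (i : nat) == qflip t j then 1 else 0)
    else (if (i : nat) == (j : nat) then 1 else 0).

Definition gate_mx (w d : nat) (x : 'I_d -> R) (g : gate R w d) : 'M[C]_(2 ^ w) :=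
  match g with
  | G_CNOT c t _ => cnot_mx c t
  | G_H q => embed1 q h_u
  | G_RX q th => embed1 q (rx_u th)
  | G_RY q th => embed1 q (ry_u th)
  | G_RZ q th => embed1 q (rz_u th)
  | G_S q j => embed1 q (s_u (x j))
  end.

Definition circuit_mx (w d : nat) (cs : seq (gate R w d)) (x : 'I_d -> R)
  : 'M[C]_(2 ^ w) :=
  foldl (fun M g => gate_mx x g *m M) 1%:M cs.

Definition adjoint (m : nat) (A : 'M[C]_m) : 'M[C]_m :=
  \matrix_(i, j) conjc (A j i).

Definition Z0 (w : nat) : 'M[C]_(2 ^ w) :=
  \matrix_(i, j) if i == j then (if qbit 0 i then -1 else 1) else 0.

Definition ket0 (w : nat) : 'cV[C]_(2 ^ w) :=
  \col_i (if (i : nat) == 0%N then 1 else 0).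

(* f_W(x) = <0| W(x)^dagger Z^(0) W(x) |0> (real part; it is real) *)
Definition pqc_output (w d : nat) (cs : seq (gate R w d)) (x : 'I_d -> R) : R :=
  let W := circuit_mx cs x in
  complex.Re ((((ket0 w)^T *m adjoint W) *m Z0 w *m W *m ket0 w) ord0 ord0).

End Semantics.

Definition gate_qubits (R : Type) (w d : nat) (g : gate R w d) : seq 'I_w :=
  match g with
  | G_CNOT c t _ => [:: c; t]
  | G_H q | G_RX q _ | G_RY q _ | G_RZ q _ | G_S q _ => [:: q]
  end.

(* ASAP layering: each gate is placed in the layer just after the latest
   layer used by any of its qubits; the depth is the number of layers. *)
Definition schedule_step (R : Type) (w d : nat) (lv : 'I_w -> nat) (g : gate R w d)
  : 'I_w -> nat :=
  let l := (\max_(q <- gate_qubits g) lv q).+1 in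
  fun q => if q \in gate_qubits g then l else lv q.

Definition circuit_depth (R : Type) (w d : nat) (cs : seq (gate R w d)) : nat :=
  let lv := foldl (@schedule_step R w d) (fun _ => 0%N) cs in
  \max_(q : 'I_w) lv q.

Definition is_trainable (R : Type) (w d : nat) (g : gate R w d) : bool :=
  match g with G_RX _ _ | G_RY _ _ | G_RZ _ _ => true | _ => false end.

Definition num_params (R : Type) (w d : nat) (cs : seq (gate R w d)) : nat :=
  count (@is_trainable R w d) cs.

Definition in_unit_cube (R : realType) (d : nat) (x : 'I_d -> R) : Prop :=
  forall i, 0 <= x i <= 1.

Definition sup_dist (R : realType) (d : nat) (x y : 'I_d -> R) : R :=
  \big[Num.max/0]_(i < d) `|x i - y i|.

(* Main.v *)
(** The data-encoding gate is the rotation e^{i theta X} with theta = arccos x. A register of t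
    qubits, on which bit s is rotated by 2^(t-1-s) encoding gates and then corrected by an angle
    depending on the lower bits, is left in a state whose index k has the Fejer distribution
    prod_(s < t) cos^2 (2^s (theta - pi k / 2^t)), with 2^t <= n < 2^(t+1). One such register for
    each coordinate selects a grid point with coordinates |cos (pi k_j / 2^t)|; a uniformly
    controlled rotation of the output qubit by arccos f(grid point) then makes the expectation of Z
    equal to the Fejer average of f. As sin phi * prod_(s < t) cos (2^s phi) = sin (2^t phi) / 2^t,
    each of the 2^t terms of the second moment of sin (theta - pi k / 2^t) is at most 4^-t, so the
    mean square deviation in each coordinate is at most 2^-t < 2 / n. *)
Require Import Defs.
From mathcomp Require Import all_boot all_order all_algebra.
From mathcomp Require Import boolp reals trigo.
From mathcomp Require Import complex.
From mathcomp Require Import zify ring lra.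
Set Implicit Arguments. Unset Strict Implicit. Unset Printing Implicit Defensive.
Import Order.TTheory GRing.Theory Num.Theory.
Local Open Scope ring_scope.

(** * Bits and the action of gates on amplitudes *)

Lemma qbit0 a : qbit 0 a = odd a.
Proof. by rewrite /qbit expn0 divn1. Qed.

Lemma qbitS k a : qbit k.+1 a = qbit k a./2.
Proof. by rewrite /qbit expnS divnMA divn2. Qed.

Lemma qbit_double k (b : bool) a : qbit k.+1 (b + a.*2) = qbit k a.
Proof. by rewrite qbitS half_bit_double. Qed.

Lemma qflip0 a : qflip 0 a = (~~ odd a + a./2.*2)%N.
Proof.
by rewrite /qflip qbit0 expn0; have := odd_double_half a; case: (odd a) => /=; lia.
Qed.

Lemma qflipS k a : qflip k.+1 a = (odd a + (qflip k a./2).*2)%N.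
Proof.
rewrite /qflip qbitS expnS mul2n; have := odd_double_half a.
case: ifP => [H|_]; last lia.
have : (2 ^ k <= a./2)%N.
  by rewrite leqNgt; apply: contraTN H => lt; rewrite /qbit divn_small.
lia.
Qed.

Lemma qbit_qflip j k a : qbit j (qflip k a) = qbit j a (+) (j == k).
Proof.
elim: k j a => [|k IH] [|j] a.
- by rewrite qflip0 !qbit0 eqxx oddD odd_double addbF oddb addbT.
- by rewrite qflip0 qbit_double -qbitS addbF.
- by rewrite qflipS !qbit0 oddD odd_double addbF oddb addbF.
- by rewrite qflipS qbit_double IH -qbitS eqSS.
Qed.

Lemma qflip_lt w k a : (k < w)%N -> (qflip k a < 2 ^ w)%N = (a < 2 ^ w)%N.
Proof.
elim: w k a => // w IH [|k] a kw.
  by rewrite qflip0 expnS mul2n; have := odd_double_half a; case: (odd a) => /=; lia.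
rewrite qflipS expnS mul2n; have := odd_double_half a.
have := IH k a./2 kw; case: (odd a) => /=; lia.
Qed.

Lemma qbit_inj w a b : (a < 2 ^ w)%N -> (b < 2 ^ w)%N ->
  (forall k, (k < w)%N -> qbit k a = qbit k b) -> a = b.
Proof.
elim: w a b => [|w IH] a b.
  by rewrite expn0 !ltnS !leqn0 => /eqP-> /eqP->.
rewrite expnS mul2n => aw bw H.
rewrite -[a]odd_double_half -[b]odd_double_half -!qbit0 H //.
congr (_ + _.*2)%N; apply: IH => [||k kw]; try lia.
by rewrite -!qbitS H.
Qed.

Lemma qflipK k : involutive (qflip k).
Proof.
move=> a; set w := (maxn a k).+1.
have aw : (a < 2 ^ w)%N.
  by apply: (ltn_trans (ltn_expl a (isT : (1 < 2)%N))); rewrite ltn_exp2l // ltnS leq_maxl.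
have kw : (k < w)%N by rewrite ltnS leq_maxr.
apply: (@qbit_inj w) => // [|j _]; first by rewrite !qflip_lt.
by rewrite !qbit_qflip -addbA addbb addbF.
Qed.

Section Action.
Variable R : realType.
Local Notation C := R[i].

(* A state is given by its amplitudes on all of [nat], although only those below 2^w matter. *)
Definition vec w (psi : nat -> C) : 'cV[C]_(2 ^ w) := \col_i psi i.

Definition act1 (q : nat) (u : bool -> bool -> C) (psi : nat -> C) (i : nat) : C :=
  u (qbit q i) (qbit q i) * psi i + u (qbit q i) (~~ qbit q i) * psi (qflip q i).

Definition act_cnot (c t : nat) (psi : nat -> C) (i : nat) : C :=
  if qbit c i then psi (qflip t i) else psi i.

Definition act w d (x : 'I_d -> R) (g : gate R w d) : (nat -> C) -> nat -> C :=
  match g with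
  | G_CNOT c t _ => act_cnot c t
  | G_H q => act1 q (@h_u R)
  | G_RX q th => act1 q (rx_u th)
  | G_RY q th => act1 q (ry_u th)
  | G_RZ q th => act1 q (rz_u th)
  | G_S q j => act1 q (s_u (x j))
  end.

(** Row [i] of the embedded gate has at most two nonzero entries, in columns [i] and [qflip q i]. *)
Lemma embed1_vec w (q : 'I_w) u psi : embed1 q u *m vec w psi = vec w (act1 q u psi).
Proof.
apply/colP => i; rewrite !mxE /act1.
have fi : (qflip q i < 2 ^ w)%N by rewrite qflip_lt.
rewrite (bigD1 i) //= !mxE (bigD1 (Ordinal fi)) /=; last first.
  apply/eqP => /(congr1 val) /= E; have := qbit_qflip q q i.
  by rewrite E eqxx addbT; case: qbit.
rewrite !mxE /= big1 => [|j /andP[ji jf]]; last first.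
  rewrite !mxE; case: ifP => [/forallP E|_]; last by rewrite mul0r.
  have {}E k : (k < w)%N -> k != q -> qbit k i = qbit k j.
    by move=> kw kq; apply/eqP; have := E (Ordinal kw); rewrite -val_eqE /= kq.
  have [Eq|Nq] := boolP (qbit q j == qbit q i).
    case/negP: ji; apply/eqP/val_inj/(@qbit_inj w) => [||k kw]; [exact: ltn_ord..|].
    by have [->|kq] := eqVneq k q; [apply/eqP|rewrite E].
  case/negP: jf; apply/eqP/val_inj/(@qbit_inj w) => [||k kw /=]; [exact: ltn_ord..|].
  rewrite qbit_qflip; have [->|kq] := eqVneq k q; last by rewrite E // addbF.
  by move: Nq; rewrite addbT; case: qbit; case: qbit.
rewrite addr0; congr (_ * _ + _ * _).
  by case: ifP => // /negbT/forallPn[k]; rewrite eqxx implybT.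
rewrite qbit_qflip eqxx addbT.
case: ifP => // /negbT/forallPn[k]; rewrite qbit_qflip negb_imply val_eqE => /andP[/negbTE->].
by rewrite addbF eqxx.
Qed.

Lemma cnot_vec w (c t : 'I_w) psi : c != t ->
  cnot_mx R c t *m vec w psi = vec w (act_cnot c t psi).
Proof.
move=> ct; apply/colP => i; rewrite !mxE /act_cnot.
have cE a : qbit c (qflip t a) = qbit c a.
  by rewrite qbit_qflip val_eqE (negbTE ct) addbF.
have fi : (qflip t i < 2 ^ w)%N by rewrite qflip_lt.
have [Hc|Hc] := boolP (qbit c i).
  rewrite (bigD1 (Ordinal fi)) //= !mxE /= cE Hc qflipK eqxx mul1r.
  rewrite big1 ?addr0 // => j ji; rewrite !mxE; case: ifP => [Hj|Hj].
    case: eqP => [E|_]; last by rewrite mul0r.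
    by case/eqP: ji; apply/val_inj; rewrite /= E qflipK.
  case: eqP => [E|_]; last by rewrite mul0r.
  by rewrite -E Hc in Hj.
rewrite (bigD1 i) //= !mxE /= (negbTE Hc) eqxx mul1r.
rewrite big1 ?addr0 // => j ji; rewrite !mxE; case: ifP => [Hj|Hj].
  case: eqP => [E|_]; last by rewrite mul0r.
  by rewrite E cE Hj in Hc.
case: eqP => [E|_]; last by rewrite mul0r.
by case/eqP: ji; apply/val_inj.
Qed.

Definition run w d (x : 'I_d -> R) (cs : seq (gate R w d)) (psi : nat -> C) : nat -> C :=
  foldl (fun psi g => act x g psi) psi cs.

Lemma run_cat w d (x : 'I_d -> R) (cs1 cs2 : seq (gate R w d)) psi :
  run x (cs1 ++ cs2) psi = run x cs2 (run x cs1 psi).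
Proof. exact: foldl_cat. Qed.

Lemma gate_vec w d (x : 'I_d -> R) (g : gate R w d) psi :
  gate_mx x g *m vec w psi = vec w (act x g psi).
Proof. by case: g => *; [exact: cnot_vec|..]; exact: embed1_vec. Qed.

Lemma circuit_vec w d (x : 'I_d -> R) (cs : seq (gate R w d)) psi :
  circuit_mx cs x *m vec w psi = vec w (run x cs psi).
Proof.
elim/last_ind: cs => [|cs g IH]; first by rewrite /circuit_mx /= mul1mx.
by rewrite -cats1 run_cat /circuit_mx foldl_cat /= -mulmxA -/(circuit_mx _ _) IH gate_vec.
Qed.

Definition sqnorm (z : C) : R := complex.Re z ^+ 2 + complex.Im z ^+ 2.

(** [Z0] is diagonal in the computational basis, so only outcome probabilities enter, signed by bit
    0. *)
Lemma pqc_outputE w d (cs : seq (gate R w d)) (x : 'I_d -> R) :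
  pqc_output cs x =
  \sum_(0 <= i < 2 ^ w) (-1) ^+ qbit 0 i * sqnorm (run x cs (fun i => (i == 0%N)%:R) i).
Proof.
rewrite /pqc_output; set W := circuit_mx cs x.
have kE : ket0 R w = vec w (fun i => (i == 0%N)%:R).
  by apply/colP => i; rewrite !mxE; case: eqP.
rewrite -[_ *m W *m _]mulmxA kE circuit_vec; set psi := run x cs _.
have aE : (vec w (fun i => (i == 0%N)%:R))^T *m adjoint W =
    \row_i conjc (vec w psi i ord0).
  apply/rowP => i; rewrite -circuit_vec !mxE rmorph_sum /=.
  apply: eq_bigr => j _; rewrite !mxE rmorphM mulrC; congr (_ * _).
  by rewrite rmorph_nat.
rewrite aE mxE raddf_sum /= big_mkord; apply: eq_bigr => i _.
rewrite !mxE (bigD1 i) //= big1 ?addr0 => [|j ji]; last first.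
  by rewrite !mxE (negbTE ji) mulr0.
rewrite !mxE eqxx /sqnorm; case: (psi i) => a b.
by case: (qbit 0 i) => /=; ring.
Qed.

End Action.

(** * Uniformly controlled rotations *)

Lemma ltn_exp_qbit k i : (i < 2 ^ k)%N = ~~ qbit k i && (i < 2 ^ k.+1)%N.
Proof.
have k0 : (0 < 2 ^ k)%N by rewrite expn_gt0.
rewrite expnS mul2n; have [ik|ki] := ltnP i (2 ^ k).
  by rewrite /qbit divn_small //; lia.
case: ltnP => [ik|]; last by rewrite andbF.
rewrite /qbit; suff -> : (i %/ 2 ^ k)%N = 1%N by [].
by rewrite -[i in LHS](subnKC ki) -{1}[(2 ^ k)%N]mul1n divnMDl // divn_small //; lia.
Qed.

Lemma qflip_lt_exp k i : (qflip k i < 2 ^ k)%N = qbit k i && (i < 2 ^ k.+1)%N.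
Proof. by rewrite ltn_exp_qbit qflip_lt // qbit_qflip eqxx addbT negbK. Qed.

(** The head of the list is the least significant bit. *)
Definition numb w (cs : seq 'I_w) (i : nat) : nat :=
  foldr (fun (c : 'I_w) m => (qbit c i + m.*2)%N) 0%N cs.

Lemma numb_qflip w (cs : seq 'I_w) q i :
  all (fun c : 'I_w => c != q :> nat) cs -> numb cs (qflip q i) = numb cs i.
Proof.
elim: cs => //= c cs IH /andP[cq /IH->].
by rewrite qbit_qflip (negbTE cq) addbF.
Qed.

Section Rotations.
Variable R : realType.
Local Notation C := R[i].
Implicit Types (psi : nat -> C) (b g : nat -> R).

(* The rotation e^{i b X} of qubit q, by an angle controlled by the other qubits. *)
Definition rot (q : nat) b psi (i : nat) : C :=
  Complex (cos (b i)) 0 * psi i + Complex 0 (sin (b i)) * psi (qflip q i).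

(** By the hypothesis the inner angle is not controlled by [q] itself, so it is the same for the two
    amplitudes being mixed and the addition formulas apply. *)
Lemma rotD q b g psi : (forall i, g (qflip q i) = g i) ->
  rot q b (rot q g psi) = rot q (fun i => b i + g i) psi.
Proof.
move=> gq; apply/funext => i; rewrite /rot qflipK gq cosD sinD.
have -> : Complex (cos (b i) * cos (g i) - sin (b i) * sin (g i)) 0 =
  Complex (cos (b i)) 0 * Complex (cos (g i)) 0 +
  Complex 0 (sin (b i)) * Complex 0 (sin (g i)) :> C.
  by apply/eqP; rewrite eq_complex /=; apply/andP; split; apply/eqP; ring.
have -> : Complex 0 (sin (b i) * cos (g i) + cos (b i) * sin (g i)) =
  Complex 0 (sin (b i)) * Complex (cos (g i)) 0 +
  Complex (cos (b i)) 0 * Complex 0 (sin (g i)) :> C.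
  by apply/eqP; rewrite eq_complex /=; apply/andP; split; apply/eqP; ring.
ring.
Qed.

Lemma rot0 q psi : rot q (fun=> 0) psi = psi.
Proof.
apply/funext => i; rewrite /rot cos0 sin0.
by rewrite -[Complex 1 0]/(1 : C) -[Complex 0 0]/(0 : C) mul1r mul0r addr0.
Qed.

Lemma act1_rx q th psi : act1 q (rx_u th) psi = rot q (fun=> - (th / 2)) psi.
Proof.
apply/funext => i; rewrite /act1 /rot /rx_u cosN sinN eqxx.
by case: qbit.
Qed.

Lemma act1_s q (x : R) psi : 0 <= x <= 1 -> act1 q (s_u x) psi = rot q (fun=> acos x) psi.
Proof.
move=> /andP[x0 x1]; have xB : -1 <= x <= 1 by rewrite x1 andbT; lra.
apply/funext => i; rewrite /act1 /rot /s_u eqxx sin_acos // acosK ?in_itv //=.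
by case: qbit.
Qed.

Definition cphase (c q : nat) psi (i : nat) : C :=
  if qbit c i && qbit q i then - psi i else psi i.

(** Z X Z = -X: the conjugation reverses the rotation on the branch where bit [c] is set and leaves
    the other branch alone. *)
Lemma cphase_rot c q b psi : c != q ->
  cphase c q (rot q b (cphase c q psi)) = rot q (fun i => (-1) ^+ qbit c i * b i) psi.
Proof.
move=> /negbTE cq; apply/funext => i.
rewrite /cphase /rot !qbit_qflip cq eqxx addbF addbT.
have sN a : Complex 0 (- a) = - Complex 0 a :> C.
  by apply/eqP; rewrite eq_complex /= oppr0 !eqxx.
by case: (qbit c i); case: (qbit q i);
  rewrite /= ?expr0 ?expr1 ?mul1r ?mulN1r ?cosN ?sinN ?sN //; ring.
Qed.

Section Gadgets.
Variables w d : nat.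
Implicit Types (cs : seq 'I_w) (x : 'I_d -> R).

(** A CNOT carries a proof that its qubits differ. Deciding this here keeps the definition total,
    with the empty circuit as default for [c = q]. *)
Definition cz (c q : 'I_w) : seq (gate R w d) :=
  if @idP (c != q) is ReflectT h then [:: G_H R d q; G_CNOT R d h; G_H R d q] else [::].

(** H X H = Z on the target turns the CNOT into a controlled Z. *)
Lemma run_cz x (c q : 'I_w) psi : c != q ->
  run x (cz c q) psi = cphase c q psi.
Proof.
rewrite /cz; case: {-}_ / idP => // h _; apply/funext => i.
rewrite /cphase /= /act1 /act_cnot !qbit_qflip !eqxx !qflipK !addbT.
have -> : (c == q :> nat) = false by rewrite val_eqE (negbTE h).
rewrite addbF.
pose r : C := Complex (1 / Num.sqrt 2) 0.
have hE (e1 e2 : bool) : h_u R e1 e2 = (-1) ^+ (e1 && e2) * r.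
  rewrite /h_u /r; case: andb; rewrite ?expr0 ?expr1 ?mul1r //.
  by apply/eqP; rewrite eq_complex /=; apply/andP; split; apply/eqP; ring.
have hr : r * r + r * r = 1.
  have s2 : Num.sqrt 2 * Num.sqrt 2 = 2 :> R by rewrite -expr2 sqr_sqrtr.
  have s0 : Num.sqrt 2 != 0 :> R by rewrite gt_eqF // sqrtr_gt0.
  apply/eqP; rewrite eq_complex /=; apply/andP; split; apply/eqP; last by ring.
  have -> : 1 / Num.sqrt 2 * (1 / Num.sqrt 2) = 1 / 2 :> R by rewrite !mul1r -invfM s2.
  by lra.
rewrite !hE; set a := psi i; set a' := psi (qflip q i).
(* Once the factor [r * r + r * r] is inserted on the right, both sides agree as polynomials in
   [r]. *)
have key z : z = (r * r + r * r) * z by rewrite hr mul1r.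
by case: (qbit c i); case: (qbit q i) => /=; rewrite ?expr0 ?expr1 [in RHS](key a); ring.
Qed.

(** The factor -2 at the leaf converts the convention e^{-i theta X / 2} of [G_RX] into e^{i al
    X}. *)
Fixpoint ucrx (q : 'I_w) cs (al : nat -> R) : seq (gate R w d) :=
  if cs is c :: cs' then
    ucrx q cs' (fun m => (al m.*2 + al m.*2.+1) / 2) ++ cz c q ++
    ucrx q cs' (fun m => (al m.*2 - al m.*2.+1) / 2) ++ cz c q
  else [:: G_RX d q (- 2 * al 0%N)].

(* Conjugating by the controlled Z negates the rotation angle exactly where the control bit is set,
   so the half-sum and half-difference of the two angle tables add up to the right one. *)
Lemma run_ucrx x (q : 'I_w) cs al psi : q \notin cs ->
  run x (ucrx q cs al) psi = rot q (fun i => al (numb cs i)) psi.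
Proof.
elim: cs al psi => [|c cs IH] al psi.
  by move=> _; rewrite /= act1_rx; congr (rot q _ psi); apply/funext => i /=; field.
rewrite in_cons negb_or => /andP[qc qcs] /=.
have cq : c != q by rewrite eq_sym.
rewrite !run_cat !IH // !run_cz // cphase_rot // rotD => [|i]; last first.
  rewrite numb_qflip //; apply/allP => c' c'cs; rewrite val_eqE.
  by apply: contraNneq qcs => <-.
congr (rot q _ psi); apply/funext => i.
by case: qbit; rewrite ?expr0 ?expr1 /= ?add0n ?add1n; field.
Qed.

Definition block (q : 'I_w) (js : seq 'I_d) cs (al : nat -> R) : seq (gate R w d) :=
  [seq G_S R q j | j <- js] ++ ucrx q cs al.

Definition angle x (js : seq 'I_d) cs (al : nat -> R) (i : nat) : R :=
  \sum_(j <- js) acos (x j) + al (numb cs i).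

Lemma run_block x (q : 'I_w) js cs al psi : in_unit_cube x -> q \notin cs ->
  run x (block q js cs al) psi = rot q (angle x js cs al) psi.
Proof.
move=> xB qcs; rewrite run_cat run_ucrx //.
have -> : run x [seq G_S R q j | j <- js] psi = rot q (fun=> \sum_(j <- js) acos (x j)) psi.
  elim/last_ind: js => [|js j IH]; first by rewrite /= big_nil rot0.
  rewrite map_rcons -cats1 run_cat IH /= act1_s // rotD //.
  by congr (rot q _ psi); apply/funext => i; rewrite -cats1 big_cat big_seq1 addrC.
by rewrite rotD //; congr (rot q _ psi); apply/funext => i; rewrite addrC.
Qed.

End Gadgets.

(** The amplitude of outcome [b] when e^{i a X} acts on a qubit in state 0. *)
Definition amp (b : bool) (a : R) : C := if b then Complex 0 (sin a) else Complex (cos a) 0.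

Definition amp2 (b : bool) (a : R) : R := if b then sin a ^+ 2 else cos a ^+ 2.

Lemma sqnorm_amp (e : bool) a : sqnorm (amp e a) = amp2 e a.
Proof. by case: e; rewrite /sqnorm /= expr0n ?addr0 ?add0r. Qed.

Lemma sqnormM (y z : C) : sqnorm (y * z) = sqnorm y * sqnorm z.
Proof. by case: y => y1 y2; case: z => z1 z2; rewrite /sqnorm /=; ring. Qed.

Lemma sqnorm1 : sqnorm (1 : C) = 1.
Proof. by rewrite /sqnorm /=; ring. Qed.

(** * Outcome distribution of a chain of controlled rotations *)

Section Layout.
Variables (W d : nat) (x : 'I_d -> R).
Variables (js : nat -> seq 'I_d) (cs : nat -> seq 'I_W.+1) (al : nat -> nat -> R).
Hypothesis xB : in_unit_cube x.
Hypothesis csP : forall r, (r < W)%N -> all (fun c : 'I_W.+1 => (0 < c <= r)%N) (cs r).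

Definition chain r : seq (gate R W.+1 d) :=
  flatten [seq block (inord k.+1) (js k) (cs k) (al k) | k <- iota 0 r].

Definition init (i : nat) : C := (i == 0%N)%:R.

Let ang k i := angle x (js k) (cs k) (al k) i.

Let ang_qflip q k i : (k < W)%N -> (k < q)%N || (q == 0%N) -> ang k (qflip q i) = ang k i.
Proof.
move=> kW kq; rewrite /ang /angle numb_qflip //; apply: sub_all (csP kW) => c.
by move: kq; case: (q) => [|q'] /=; lia.
Qed.

(** Block [k] rotates the fresh qubit [k + 1], controlled by qubits whose rotations are finished, so
    amplitudes multiply like conditional probabilities. The indicator records that qubit 0 and the
    qubits above [r] are still 0. *)
Lemma run_chain r : (r <= W)%N -> run x (chain r) init =
  fun i => (~~ odd i && (i < 2 ^ r.+1)%N)%:R * \prod_(0 <= k < r) amp (qbit k.+1 i) (ang k i).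
Proof.
elim: r => [_|r IH rW].
  by apply/funext => i; rewrite big_geq // mulr1 /init; case: i => [|[|i]] //=; rewrite ltnS andbF.
have -> : chain r.+1 = chain r ++ block (inord r.+1) (js r) (cs r) (al r).
  have iS : iota 0 r.+1 = iota 0 r ++ [:: r] by rewrite -addn1 iotaD.
  by rewrite /chain iS map_cat flatten_cat /= cats0.
rewrite run_cat IH 1?ltnW //.
have qE : (inord r.+1 : 'I_W.+1) = r.+1 :> nat by rewrite inordK.
rewrite run_block //; last first.
  by apply/negP => /(allP (csP rW)); rewrite qE ltnn andbF.
rewrite qE; apply/funext => i; rewrite big_nat_recr //= /rot -/(ang r i).
have -> : odd (qflip r.+1 i) = odd i by rewrite -!qbit0 qbit_qflip addbF.
have -> : \prod_(0 <= k < r) amp (qbit k.+1 (qflip r.+1 i)) (ang k (qflip r.+1 i)) =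
          \prod_(0 <= k < r) amp (qbit k.+1 i) (ang k i).
  apply: eq_big_nat => k /andP[_ kr]; rewrite ang_qflip ?(ltn_trans kr) ?ltnS ?(ltnW kr) //.
  by rewrite qbit_qflip eqSS (ltn_eqF kr) addbF.
(* Qubit [r + 1] is 0 before this block, so at most one of the two terms of the rotation survives,
   selected by its bit in [i]. *)
rewrite qflip_lt_exp ltn_exp_qbit.
by case: (qbit r.+1 i); rewrite /= ?andbF ?mul0r ?mulr0 ?add0r ?addr0 /amp; ring.
Qed.

(** The output qubit is rotated last and controls nothing, so it contributes a separate factor;
    squared moduli then turn amplitudes into probabilities. *)
Lemma pqc_output_chain js0 cs0 al0 :
  all (fun c : 'I_W.+1 => (0 < c)%N) cs0 ->
  pqc_output (chain W ++ block ord0 js0 cs0 al0) x =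
  \sum_(0 <= i < 2 ^ W.+1) (-1) ^+ odd i * amp2 (odd i) (angle x js0 cs0 al0 i) *
     \prod_(0 <= k < W) amp2 (qbit k.+1 i) (ang k i).
Proof.
move=> cs0P; rewrite pqc_outputE; apply: eq_big_nat => i /andP[_ iW].
rewrite qbit0 -mulrA; congr (_ * _).
rewrite run_cat run_chain // run_block //; last by apply/negP => /(allP cs0P).
set g := angle _ _ _ _.
suff -> : rot (@ord0 W) g
    (fun i => (~~ odd i && (i < 2 ^ W.+1)%N)%:R * \prod_(0 <= k < W) amp (qbit k.+1 i) (ang k i)) i =
    amp (odd i) (g i) * \prod_(0 <= k < W) amp (qbit k.+1 i) (ang k i).
  rewrite sqnormM sqnorm_amp; congr (_ * _).
  by rewrite (big_morph _ sqnormM sqnorm1); apply: eq_bigr => k _; rewrite sqnorm_amp.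
rewrite /rot qflip_lt // iW -!qbit0 qbit_qflip eqxx addbT.
have -> : \prod_(0 <= k < W) amp (qbit k.+1 (qflip 0 i)) (ang k (qflip 0 i)) =
          \prod_(0 <= k < W) amp (qbit k.+1 i) (ang k i).
  by apply: eq_big_nat => k /andP[_ kW]; rewrite ang_qflip ?orbT // qbit_qflip addbF.
by case: (qbit 0 i); rewrite /= ?mul0r ?mul1r ?mulr0 ?add0r ?addr0.
Qed.

End Layout.
End Rotations.

(** * The Fejer distribution *)

Section Fejer.
Variable R : realType.
Implicit Types (a th : R).

Lemma cos_sub_pi_sqr a n : cos (a - n%:R * pi) ^+ 2 = cos a ^+ 2.
Proof.
elim: n => [|n IH]; first by rewrite mul0r subr0.
rewrite -IH -[in RHS](subrK pi (a - n%:R * pi)) cosDpi sqrrN.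
by congr (cos _ ^+ 2); rewrite -natr1; ring.
Qed.

(** A bit equal to 1 amounts to a quarter turn, as [sin a = cos (a - pi / 2)], and multiples of [pi]
    disappear in the square. *)
Lemma amp2_shift (e : bool) a n :
  cos (a - e%:R * (pi / 2) - n%:R * pi) ^+ 2 = amp2 e a.
Proof.
rewrite cos_sub_pi_sqr; case: e; last by rewrite mul0r subr0.
by rewrite mul1r -[in RHS](subrK (pi / 2) a) /amp2 sinDpihalf.
Qed.

Definition fejer t th (k : nat) : R :=
  \prod_(0 <= s < t) cos (2 ^+ s * (th - pi * k%:R / 2 ^+ t)) ^+ 2.

Lemma fejer_ge0 t th k : 0 <= fejer t th k.
Proof. by apply: prodr_ge0 => s _; apply: sqr_ge0. Qed.

(** Iterated double-angle formula, in a form that needs no division where [sin a] vanishes. *)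
Lemma sin_prod_cos t a : sin a * \prod_(0 <= s < t) cos (2 ^+ s * a) * 2 ^+ t = sin (2 ^+ t * a).
Proof.
elim: t => [|t IH]; first by rewrite big_geq // !mulr1 mul1r.
rewrite big_nat_recr //= exprS (_ : 2 * 2 ^+ t * a = (2 ^+ t * a) *+ 2).
  by rewrite sin_mulr2n -IH; ring.
by ring.
Qed.

Lemma fejer_sin t th k : fejer t th k * sin (th - pi * k%:R / 2 ^+ t) ^+ 2 <= 1 / (2 ^+ t) ^+ 2.
Proof.
set a := th - _; rewrite ler_pdivlMr ?exprn_gt0 ?exprn_gt0 //.
have -> : fejer t th k = (\prod_(0 <= s < t) cos (2 ^+ s * a)) ^+ 2 by rewrite -prodrXl.
rewrite -!exprMn (_ : _ * _ * _ = sin (2 ^+ t * a)); last by rewrite -sin_prod_cos; ring.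
by rewrite sin2cos2 lerBlDr lerDl sqr_ge0.
Qed.

(** At level [t + 1] the angles of [k] and [k + 2^t] differ by [pi / 2]: the first factors are cos^2
    and sin^2 of one angle, while the later factors agree and form the weight of level [t] at the
    doubled angle. *)
Lemma fejer_sum t th : \sum_(0 <= k < 2 ^ t) fejer t th k = 1.
Proof.
elim: t th => [|t IH] th.
  by rewrite expn0 big_nat1 /fejer big_geq.
rewrite -(IH (2 * th)) expnS mul2n -addnn (big_cat_nat (leq0n _) (leq_addr _ _)) /=.
rewrite -{2}[(2 ^ t)%N]add0n big_addn addnK -big_split /=.
apply: eq_bigr => k _; rewrite /fejer !big_nat_recl //= !expr0 !mul1r.
have z : 2 ^+ t != 0 :> R by rewrite expf_neq0 // pnatr_eq0.
(* The vanishing last summand gives the shift the shape required by [amp2_shift]. *)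
have -> : th - pi * (k + 2 ^ t)%:R / 2 ^+ t.+1 =
          (th - pi * k%:R / 2 ^+ t.+1) - true%:R * (pi / 2) - 0%:R * pi.
  by rewrite natrD natrX exprS /=; field.
rewrite amp2_shift /amp2; set a := th - _.
have hE (b : R) : (forall s, cos (2 ^+ s.+1 * b) ^+ 2 = cos (2 ^+ s.+1 * a) ^+ 2) ->
    \prod_(0 <= s < t) cos (2 ^+ s.+1 * b) ^+ 2 =
    \prod_(0 <= s < t) cos (2 ^+ s * (2 * th - pi * k%:R / 2 ^+ t)) ^+ 2.
  move=> H; apply: eq_bigr => s _; rewrite H; congr (cos _ ^+ 2).
  by rewrite /a !exprS; field.
rewrite !hE // => [|s]; first by rewrite -mulrDl cos2Dsin2 mul1r.
rewrite -(cos_sub_pi_sqr (2 ^+ s.+1 * a) (2 ^ s)); congr (cos _ ^+ 2).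
by rewrite natrX /= !exprS; field.
Qed.

(** In [pi k / 2^(s+1)] the bits of [k] below [s] give the explicit correction, bit [s] gives a
    multiple of [pi / 2], and the higher bits give multiples of [pi]. Hence the rotation of bit [s]
    needs only the lower bits. *)
Lemma amp2_fejer t th k s : (s < t)%N ->
  amp2 (qbit s k) (2 ^+ (t - s.+1) * th - pi * (k %% 2 ^ s)%:R / 2 ^+ s.+1) =
  cos (2 ^+ (t - s.+1) * (th - pi * k%:R / 2 ^+ t)) ^+ 2.
Proof.
move=> st; rewrite -(amp2_shift _ _ (k %/ 2 ^ s)./2); congr (cos _ ^+ 2).
rewrite mulrBr -2!addrA; congr (_ + _).
have -> : k%:R = (k %% 2 ^ s)%:R + 2 ^+ s * ((qbit s k)%:R + 2 * ((k %/ 2 ^ s)./2)%:R) :> R.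
  rewrite {1}(divn_eq k (2 ^ s)) -[in LHS](odd_double_half (k %/ 2 ^ s)) -/(qbit s k).
  by rewrite -mul2n !(natrD, natrM, natrX); ring.
have -> : 2 ^+ t = 2 ^+ (t - s.+1) * (2 * 2 ^+ s) :> R by rewrite -exprS -exprD subnK.
have z : 2 ^+ s != 0 :> R by rewrite expf_neq0 // pnatr_eq0.
have z2 : 2 ^+ (t - s.+1) != 0 :> R by rewrite expf_neq0 // pnatr_eq0.
by rewrite [2 ^+ s.+1]exprS; field; rewrite ?z ?z2.
Qed.

(** Both [|cos ph|] and the squared sine see [ph] only modulo [pi]. The difference of the two sides
    is [2 cos th (|cos ph| - cos ph cos (th - ph))], which is nonnegative. *)
Lemma cos_abs_dist th ph : 0 <= cos th -> (cos th - `|cos ph|) ^+ 2 <= sin (th - ph) ^+ 2.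
Proof.
move=> c0; have c1 := sin2cos2 th; have c2 := sin2cos2 ph.
have E : sin (th - ph) ^+ 2 - (cos th ^+ 2 + cos ph ^+ 2) = - 2 * (cos th * cos ph) * cos (th - ph).
  rewrite sinB cosB.
  transitivity (sin th ^+ 2 * cos ph ^+ 2 + cos th ^+ 2 * sin ph ^+ 2
    - 2 * (sin th * cos ph * cos th * sin ph) - (cos th ^+ 2 + cos ph ^+ 2)); first by ring.
  by rewrite c1 c2; ring.
have u1 := cos_le1 (th - ph); have u2 := cos_geN1 (th - ph).
rewrite -subr_ge0 sqrrB real_normK ?num_real //.
have -> : sin (th - ph) ^+ 2 - (cos th ^+ 2 - cos th * `|cos ph| *+ 2 + cos ph ^+ 2) =
  2 * (cos th * `|cos ph|) - 2 * (cos th * cos ph) * cos (th - ph) by lra.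
have [h|h] := ger0P (cos ph).
  have := mulr_ge0 (mulr_ge0 c0 h) (_ : 0 <= 1 - cos (th - ph)); rewrite subr_ge0 => /(_ u1); lra.
have h' : 0 <= - cos ph by rewrite oppr_ge0 ltW.
have := mulr_ge0 (mulr_ge0 c0 h') (_ : 0 <= 1 + cos (th - ph)); rewrite -lerBlDl sub0r => /(_ u2); lra.
Qed.

End Fejer.

(** * Base [2^t] digits and product distributions *)

Section Digits.
Variables (R : realType) (d t : nat).

Definition digit (m j : nat) : nat := ((m %/ 2 ^ (j * t)) %% 2 ^ t)%N.

Lemma digit_lt m j : (digit m j < 2 ^ t)%N.
Proof. by rewrite ltn_mod expn_gt0. Qed.

Lemma qbit_mod s u m : (s < u)%N -> qbit s (m %% 2 ^ u) = qbit s m.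
Proof.
move=> su; rewrite {2}(divn_eq m (2 ^ u)) /qbit.
have -> : (m %/ 2 ^ u * 2 ^ u = m %/ 2 ^ u * 2 ^ (u - s.+1) * 2 * 2 ^ s)%N.
  by rewrite -!mulnA -expnS -expnD subnK.
by rewrite divnMDl ?expn_gt0 // oddD oddM andbF.
Qed.

Lemma qbit_div s a m : qbit s (m %/ 2 ^ a) = qbit (a + s) m.
Proof. by rewrite /qbit -divnMA expnD. Qed.

Lemma qbit_digit m j s : (s < t)%N -> qbit s (digit m j) = qbit (j * t + s) m.
Proof. by move=> st; rewrite qbit_mod // qbit_div. Qed.

Definition digits (m : 'I_(2 ^ (d * t))) : {ffun 'I_d -> 'I_(2 ^ t)} :=
  [ffun j : 'I_d => Ordinal (digit_lt m j)].

(** Bit [k] of [m] is bit [k %% t] of digit [k %/ t], so the digits determine [m]; the cardinalities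
    agree. *)
Lemma digits_bij : bijective digits.
Proof.
apply: inj_card_bij; last by rewrite card_ffun !card_ord mulnC expnM.
move=> m m' E; apply/val_inj/(@qbit_inj (d * t)) => [||k kdt]; [exact: ltn_ord..|].
have t0 : (0 < t)%N by case: (t) kdt => //; rewrite muln0.
have jd : (k %/ t < d)%N by rewrite ltn_divLR.
have {E} := congr1 (fun g : {ffun 'I_d -> 'I_(2 ^ t)} => qbit (k %% t) (g (Ordinal jd))) E.
by rewrite !ffunE /= !qbit_digit ?ltn_mod // -divn_eq.
Qed.

Lemma sum_digits (F : {ffun 'I_d -> 'I_(2 ^ t)} -> R) :
  \sum_(m < 2 ^ (d * t)) F (digits m) = \sum_k F k.
Proof. by rewrite [RHS](reindex digits) //; apply: onW_bij digits_bij. Qed.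

Variable (p : 'I_d -> 'I_(2 ^ t) -> R).
Hypothesis p1 : forall j, \sum_k p j k = 1.

Lemma sum_prod1 : \sum_(k : {ffun 'I_d -> 'I_(2 ^ t)}) \prod_j p j (k j) = 1.
Proof. by rewrite -bigA_distr_bigA /= big1. Qed.

(** Absorbing [h] into factor [j] makes the sum factor over coordinates, and every other factor sums
    to 1. *)
Lemma sum_prod_marginal (j : 'I_d) (h : 'I_(2 ^ t) -> R) :
  \sum_(k : {ffun 'I_d -> 'I_(2 ^ t)}) h (k j) * \prod_j' p j' (k j') = \sum_k h k * p j k.
Proof.
pose q j' k := if j' == j then h k * p j' k else p j' k.
transitivity (\sum_(k : {ffun 'I_d -> 'I_(2 ^ t)}) \prod_j' q j' (k j')).
  apply: eq_bigr => k _; rewrite (bigD1 j) //= [RHS](bigD1 j) //= /q eqxx mulrA.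
  by congr (_ * _); apply: eq_bigr => i /negbTE->.
rewrite -bigA_distr_bigA /= (bigD1 j) //= [X in _ * X]big1 ?mulr1 => [|i ij].
  by apply: eq_bigr => k _; rewrite /q eqxx.
by rewrite -[RHS](p1 i); apply: eq_bigr => k _; rewrite /q (negbTE ij).
Qed.

End Digits.

Lemma modn_exp2S m s : (m %% 2 ^ s.+1)%N = (odd m + (m./2 %% 2 ^ s).*2)%N.
Proof.
have h : (m./2 %% 2 ^ s < 2 ^ s)%N by rewrite ltn_mod expn_gt0.
rewrite -{1}(odd_double_half m) {1}(divn_eq m./2 (2 ^ s)) doubleD addnCA.
have -> : ((m./2 %/ 2 ^ s * 2 ^ s).*2 = m./2 %/ 2 ^ s * 2 ^ s.+1)%N.
  by rewrite expnS mulnCA mul2n.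
rewrite modnMDl modn_small // expnS mul2n; case: (odd m) => /=; lia.
Qed.

(** The bound keeps every index in range, so that [inord] never takes its default value. *)
Lemma numb_iota W a s i : (a + s <= W.+1)%N ->
  numb [seq inord k : 'I_W.+1 | k <- iota a s] i = ((i %/ 2 ^ a) %% 2 ^ s)%N.
Proof.
elim: s a => [|s IH] a h; first by rewrite expn0 modn1.
rewrite /= IH ?addSn -?addnS // modn_exp2S inordK; last by lia.
by rewrite -divn2 -divnMA -expnSr.
Qed.

(** * Gate and parameter counts *)

Section Counting.
Variables (R : realType) (w d : nat).
Implicit Types (gs : seq (gate R w d)).

(** Appending a gate raises the highest layer by at most one. *)
Lemma circuit_depth_size gs : (circuit_depth gs <= size gs)%N.
Proof.
rewrite /circuit_depth; apply/bigmax_leqP => q _.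
elim/last_ind: gs q => [//|gs g IH] q.
rewrite size_rcons -cats1 foldl_cat /= /schedule_step.
case: ifP => _; last exact: leqW.
by rewrite ltnS; apply/bigmax_leqP_seq => p _ _; apply: IH.
Qed.

Lemma size_cz c q : (size (cz R d c q : seq (gate R w d)) <= 3)%N.
Proof. by rewrite /cz; case: {-}_ / idP. Qed.

Lemma num_params_cz c q : num_params (cz R d c q : seq (gate R w d)) = 0%N.
Proof. by rewrite /cz; case: {-}_ / idP. Qed.

(** The recursion [S(k+1) <= 2 S(k) + 6] with [S(0) = 1] is solved by [7 * 2^k - 6]; the added 6
    makes the induction close. *)
Lemma size_ucrx (q : 'I_w) cs (al : nat -> R) :
  (size (ucrx d q cs al) + 6 <= 7 * 2 ^ size cs)%N.
Proof.
elim: cs al => [//|c cs IH] al /=.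
rewrite !size_cat expnS; have := size_cz c q.
move: (IH (fun m => (al m.*2 + al m.*2.+1) / 2)).
move: (IH (fun m => (al m.*2 - al m.*2.+1) / 2)).
lia.
Qed.

Lemma num_params_ucrx (q : 'I_w) cs (al : nat -> R) :
  num_params (ucrx d q cs al) = (2 ^ size cs)%N.
Proof.
elim: cs al => [//|c cs IH] al /=.
rewrite /num_params !count_cat -!/(num_params _) !IH !num_params_cz expnS; lia.
Qed.

Lemma size_block (q : 'I_w) (js : seq 'I_d) cs (al : nat -> R) :
  (size (block q js cs al) <= size js + 7 * 2 ^ size cs)%N.
Proof.
rewrite size_cat size_map leq_add2l.
by apply: leq_trans (size_ucrx q cs al); rewrite leq_addr.
Qed.

Lemma num_params_block (q : 'I_w) (js : seq 'I_d) cs (al : nat -> R) :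
  num_params (block q js cs al) = (2 ^ size cs)%N.
Proof.
rewrite /num_params count_cat -/(num_params (ucrx _ _ _ _)) num_params_ucrx.
by rewrite count_map (eq_count (a2 := pred0)) // count_pred0.
Qed.

End Counting.

Lemma size_chain (R : realType) W d js cs al r :
  size (@chain R W d js cs al r) =
  (\sum_(0 <= k < r) size (block (inord k.+1) (js k) (cs k) (al k)))%N.
Proof.
by rewrite size_flatten /shape -map_comp sumnE big_map /index_iota subn0.
Qed.

Lemma num_params_chain (R : realType) W d js cs al r :
  num_params (@chain R W d js cs al r) = (\sum_(0 <= k < r) 2 ^ size (cs k))%N.
Proof.
rewrite /num_params count_flatten -map_comp sumnE big_map /index_iota subn0.
by apply: eq_bigr => k _; rewrite /= -[RHS](num_params_block (inord k.+1) (js k) _ (al k)).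
Qed.

Lemma sum_exp2_leq t : (\sum_(0 <= s < t) 2 ^ s < 2 ^ t)%N.
Proof.
elim: t => [|t IH]; first by rewrite big_geq.
by rewrite big_nat_recr //= expnS mul2n -addnn -addSn leq_add2r.
Qed.

(** * The circuit *)

Lemma sum_nat_double (V : zmodType) n (F : nat -> V) :
  \sum_(0 <= i < n.*2) F i = \sum_(0 <= m < n) (F m.*2 + F m.*2.+1).
Proof.
elim: n => [|n IH]; first by rewrite !big_geq.
by rewrite doubleS !big_nat_recr //= IH addrA.
Qed.

Section Circuit.
Variables (R : realType) (d t : nat) (j0 : 'I_d) (f : ('I_d -> R) -> R).

Let W := (d * t)%N.

Definition node (k : 'I_d -> nat) (j : 'I_d) : R := `|cos (pi * (k j)%:R / 2 ^+ t)|.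

(* Qubit 0 is the output; qubit j t + s + 1 holds bit s of the index k_j of the grid point
   approximating arccos x_j modulo pi. *)
Definition phase_data (r : nat) : seq 'I_d := nseq (2 ^ (t - (r %% t).+1))%N (insubd j0 (r %/ t)%N).
Definition lower_bits (r : nat) : seq 'I_W.+1 := [seq inord k | k <- iota (r %/ t * t).+1%N (r %% t)%N].
(** For [m] the value of the lower bits, this is the correction term of [amp2_fejer]. *)
Definition correction (r m : nat) : R := - (pi * m%:R / 2 ^+ (r %% t).+1%N).
Definition lookup_bits : seq 'I_W.+1 := [seq inord k | k <- iota 1 W].
(** The angle is halved because the expectation of Z after e^{i a X} is [cos (2 a)]. *)
Definition lookup (m : nat) : R := acos (f (node (digit t m))) / 2.

Definition grid_circuit : seq (gate R W.+1 d) :=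
  chain phase_data lower_bits correction W ++ block ord0 [::] lookup_bits lookup.

Lemma lower_bitsP r : (r < W)%N -> all (fun c : 'I_W.+1 => (0 < c <= r)%N) (lower_bits r).
Proof.
move=> rW; apply/allP => c /mapP[k]; rewrite mem_iota => kr ->.
move: kr; rewrite addSn ltnS -divn_eq => /andP[k0 kr].
by rewrite inordK ?kr ?(leq_ltn_trans _ k0) // ltnS (leq_trans kr) // ltnW.
Qed.

Lemma lookup_bitsP : all (fun c : 'I_W.+1 => (0 < c)%N) lookup_bits.
Proof. by apply/allP => c /mapP[k]; rewrite mem_iota => kr ->; rewrite inordK; lia. Qed.

Lemma prod_fejer x m (e : bool) :
  \prod_(0 <= r < W) amp2 (qbit r.+1 (e + m.*2))
     (angle x (phase_data r) (lower_bits r) (correction r) (e + m.*2)) =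
  \prod_(j < d) fejer t (acos (x j)) (digit t m j).
Proof.
rewrite big_nat_mul big_mkord; apply: eq_bigr => j _.
(* The product is reversed because bit [s] carries the power [2^(t-1-s)] of the encoding gate. *)
rewrite mulSn addnC -{1}[(j * t)%N]add0n big_addn addKn /fejer [RHS]big_nat_rev /= add0n.
apply: eq_big_nat => s /andP[_ st].
have sE : ((j * t + s) %% t = s)%N by rewrite modnMDl modn_small.
have jE : ((j * t + s) %/ t = j)%N by rewrite divnMDl ?divn_small ?addn0 //; lia.
rewrite qbit_double (addnC s) -(qbit_digit m j st) -amp2_fejer //; congr (amp2 _ _).
rewrite /angle /phase_data /lower_bits /correction sE jE; congr (_ + - (pi * _%:R / _)).
  by rewrite big_nseq iter_addr_0 valKd -[_ *+ (2 ^ _)]mulr_natl natrX.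
rewrite numb_iota; last by have := ltn_ord j; nia.
rewrite expnS divnMA divn2 half_bit_double /digit modn_dvdm //.
by rewrite dvdn_exp2l // ltnW.
Qed.

(** For a fixed grid index the two output outcomes contribute [cos^2 - sin^2] of half of [acos f],
    that is [f]; the range of [f] makes [acos] invertible. *)
Lemma grid_circuit_output x :
  in_unit_cube x -> (forall y, in_unit_cube y -> -1 <= f y <= 1) ->
  pqc_output grid_circuit x =
  \sum_(k : {ffun 'I_d -> 'I_(2 ^ t)})
     f (node (fun j => k j)) * \prod_(j < d) fejer t (acos (x j)) (k j).
Proof.
move=> xB fB; rewrite (pqc_output_chain _ _ xB lower_bitsP _ _ lookup_bitsP).
rewrite expnS mul2n sum_nat_double big_mkord -sum_digits; apply: eq_bigr => m _.
have numE (e : bool) : numb lookup_bits (e + m.*2) = m.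
  rewrite numb_iota ?add1n // expn1 divn2 half_bit_double modn_small //.
have aE (e : bool) : angle x [::] lookup_bits lookup (e + m.*2) = lookup m.
  by rewrite /angle big_nil add0r numE.
rewrite -[m.*2]/(false + m.*2)%N -[(false + m.*2).+1]/(true + m.*2)%N !prod_fejer !aE.
rewrite !oddD odd_double /= !mul1r mulN1r -mulrDl; congr (_ * _); last first.
  by apply: eq_bigr => j _; rewrite ffunE.
have -> : node (fun j => digits m j) = node (digit t m).
  by apply/funext => j; rewrite /node ffunE.
rewrite -[RHS](acosK (x := f _)); last first.
  rewrite in_itv; apply: fB => j; rewrite /node normr_ge0 ler_norml cos_geN1 cos_le1 //.
have -> : acos (f (node (digit t m))) = lookup m *+ 2 by rewrite /lookup; field.
by rewrite cos_mulr2n sin2cos2; ring.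
Qed.

(** A register qubit for bit [s] costs at most [2^(t-1-s) + 7 * 2^s], and both powers are at most
    [2^t]; the lookup costs at most [7 * 2^(d t)]. *)
Lemma size_grid_circuit : 
  (size grid_circuit <= d * t * (8 * 2 ^ t) + 7 * 2 ^ (d * t))%N.
Proof.
rewrite size_cat size_chain leq_add //.
  rewrite -/W; have -> : (W * (8 * 2 ^ t) = \sum_(0 <= r < W) 8 * 2 ^ t)%N.
    by rewrite sum_nat_const_nat subn0.
  rewrite big_nat [leqRHS]big_nat; apply: leq_sum => r /andP[_ rW].
  apply: leq_trans (size_block _ _ _ _) _; rewrite size_nseq size_map size_iota.
  have rt : (r %% t < t)%N by rewrite ltn_mod; move: rW; rewrite /W; case: (t); lia.
  have := leq_pexp2l (isT : 0 < 2)%N (leq_subr (r %% t).+1 t).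
  have := leq_pexp2l (isT : 0 < 2)%N (ltnW rt); lia.
apply: leq_trans (size_block _ _ _ _) _.
by rewrite size_map size_iota.
Qed.

(** The corrections within one register have [1 + 2 + ... + 2^(t-1)] angles; the lookup table has
    [2^(d t)]. *)
Lemma num_params_grid_circuit : (num_params grid_circuit <= d * 2 ^ t + 2 ^ (d * t))%N.
Proof.
rewrite /num_params count_cat -/(num_params _) -/(num_params (block _ _ _ _)).
rewrite num_params_block size_map size_iota leq_add2r num_params_chain big_nat_mul big_mkord.
have -> : (d * 2 ^ t = \sum_(j < d) 2 ^ t)%N by rewrite sum_nat_const card_ord.
apply: leq_sum => j _.
rewrite mulSn addnC -{1}[(j * t)%N]add0n big_addn addKn.
apply: leq_trans (ltnW (sum_exp2_leq t)); rewrite big_nat [leqRHS]big_nat.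
apply: leq_sum => s /andP[_ st].
by rewrite size_map size_iota addnC modnMDl modn_small.
Qed.

End Circuit.

(** * The approximation error *)

Section Error.
Variable R : realType.

Lemma sup_dist_sqr d (x y : 'I_d -> R) :
  sup_dist x y ^+ 2 <= \sum_j (x j - y j) ^+ 2.
Proof.
rewrite /sup_dist; suff [] : 0 <= \big[Num.max/0]_(i < d) `|x i - y i| /\
  (\big[Num.max/0]_(i < d) `|x i - y i|) ^+ 2 <= \sum_j (x j - y j) ^+ 2 by [].
elim/big_ind2: _ => [|a A b B [a0 aA] [b0 bB]|j _]; last by rewrite real_normK ?num_real.
  by rewrite expr0n.
split; first by rewrite le_max a0.
by rewrite maxEle; case: ifP => _; [apply: le_trans bB _; rewrite lerDr|
  apply: le_trans aA _; rewrite lerDl]; apply: le_trans (sqr_ge0 _) _; eassumption.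
Qed.

Lemma bernoulli_ineq (a : R) n : 0 <= a -> 1 + n%:R * a <= (1 + a) ^+ n.
Proof.
move=> a0; elim: n => [|n IH]; first by rewrite mul0r addr0 expr0.
rewrite exprS; have : (1 + a) * (1 + n%:R * a) <= (1 + a) * (1 + a) ^+ n.
  by apply: ler_wpM2l => //; lra.
apply: le_trans; rewrite -natr1.
have : 0 <= n%:R * a * a by rewrite !mulr_ge0.
nra.
Qed.

Variables (d : nat) (l : R) (f : ('I_d -> R) -> R) (eps : R).
Hypothesis eps0 : 0 < eps.
Hypothesis fB : forall x, in_unit_cube x -> -1 <= f x <= 1.
Hypothesis fL : forall x y, in_unit_cube x -> in_unit_cube y ->
  `|f x - f y| <= l * sup_dist x y.

(* For eps < 2 this is AM-GM: l s <= eps + l^2 s^2 / (4 eps). *)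
Lemma lipschitz_quadratic x y : in_unit_cube x -> in_unit_cube y ->
  `|f x - f y| <= eps + l ^+ 2 / eps ^+ 2 * \sum_j (x j - y j) ^+ 2.
Proof.
move=> xB yB; have S2 := sup_dist_sqr x y; set S := \sum_j _ in S2 *.
have S0 : 0 <= S by apply: le_trans S2; apply: sqr_ge0.
set a := l / eps; have -> : l ^+ 2 / eps ^+ 2 = a ^+ 2 by rewrite /a expr_div_n.
have aS : 0 <= a ^+ 2 * S by rewrite mulr_ge0 ?sqr_ge0.
have [e2|e2] := lerP 2 eps.
  have /andP[? ?] := fB xB; have /andP[? ?] := fB yB.
  by rewrite ler_norml; apply/andP; split; lra.
apply: le_trans (fL xB yB) _; set s := sup_dist x y in S2 *.
have -> : l * s = eps * (a * s) by rewrite /a; field; rewrite gt_eqF.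
have : a ^+ 2 * s ^+ 2 <= a ^+ 2 * S by apply: ler_wpM2l => //; apply: sqr_ge0.
rewrite -exprMn; set u := a * s => uS.
have : 0 <= eps * (1 - u / 2) ^+ 2 by rewrite mulr_ge0 ?sqr_ge0 // ltW.
(* The preceding square gives [eps u <= eps + eps u^2 / 4], and here [eps u^2 / 4 <= u^2]. *)
have : 0 <= (4 - eps) * u ^+ 2 by rewrite mulr_ge0 ?sqr_ge0 //; lra.
lra.
Qed.

Lemma node_in_cube t (k : 'I_d -> nat) : in_unit_cube (node R t k).
Proof. by move=> j; rewrite /node normr_ge0 ler_norml cos_geN1 cos_le1. Qed.

(** The weights sum to 1, so [f x] can be moved inside the average and [lipschitz_quadratic] applied
    at each node. The squared distances then reduce to second moments of the one-coordinate
    marginals. *)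
Lemma grid_error t x : in_unit_cube x ->
  `|f x - \sum_(k : {ffun 'I_d -> 'I_(2 ^ t)})
     f (node R t (fun j => k j)) * \prod_(j < d) fejer t (acos (x j)) (k j)|
  <= eps + l ^+ 2 / eps ^+ 2 * (d%:R / 2 ^+ t).
Proof.
move=> xB; pose p (j : 'I_d) (k : 'I_(2 ^ t)) := fejer t (acos (x j)) k.
have p1 j : \sum_k p j k = 1 by rewrite -[RHS](fejer_sum t (acos (x j))) big_mkord.
set c := l ^+ 2 / eps ^+ 2.
have c0 : 0 <= c by rewrite divr_ge0 ?sqr_ge0.
pose h j (k : 'I_(2 ^ t)) := sin (acos (x j) - pi * (k : nat)%:R / 2 ^+ t) ^+ 2 : R.
rewrite -[f x]mulr1 -{1}(sum_prod1 p1) mulr_sumr -sumrB.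
apply: le_trans (ler_norm_sum _ _ _) _.
apply: (@le_trans _ _ (\sum_(k : {ffun 'I_d -> 'I_(2 ^ t)})
    (eps * \prod_j p j (k j) + c * \sum_j h j (k j) * \prod_j' p j' (k j')))).
  apply: ler_sum => k _; rewrite -mulrBl normrM.
  have P0 : 0 <= \prod_j p j (k j) by apply: prodr_ge0 => j _; apply: fejer_ge0.
  rewrite (ger0_norm P0) -mulr_suml mulrA -mulrDl; apply: ler_wpM2r => //.
  apply: le_trans (lipschitz_quadratic xB (node_in_cube _ _)) _.
  rewrite lerD2l; apply: ler_wpM2l => //; apply: ler_sum => j _.
  have /andP[x0 x1] := xB j.
  have xE : cos (acos (x j)) = x j by rewrite acosK // in_itv /= x1 andbT; lra.
  by rewrite -{1}xE; apply: cos_abs_dist; rewrite xE.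
rewrite big_split /= -mulr_sumr (sum_prod1 p1) mulr1 lerD2l -mulr_sumr.
apply: ler_wpM2l => //; rewrite exchange_big /=.
have -> : d%:R / 2 ^+ t = \sum_(j < d) 1 / 2 ^+ t :> R.
  by rewrite sumr_const card_ord mul1r mulr_natl.
apply: ler_sum => j _; rewrite (sum_prod_marginal p1 j (h j)).
(* The bound is split into [2^t] equal parts to match the termwise estimate [fejer_sin]. *)
have -> : 1 / 2 ^+ t = \sum_(k < 2 ^ t) 1 / (2 ^+ t) ^+ 2 :> R.
  have z : 2 ^+ t != 0 :> R by rewrite expf_neq0 // pnatr_eq0.
  by rewrite sumr_const card_ord -[RHS]mulr_natl natrX; field.
by apply: ler_sum => k _; rewrite mulrC; apply: fejer_sin.
Qed.

End Error.

(** * Choice of the register size and final bounds *)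

Theorem theorem2 :
  exists C1 C2 C3 : nat,
  forall (R : realType) (d : nat) (l : R) (f : ('I_d -> R) -> R) (eps : R) (n : nat),
    (0 < d)%N -> (0 < n)%N -> 0 < eps ->
    (forall x, in_unit_cube x -> -1 <= f x <= 1) ->
    (forall x y, in_unit_cube x -> in_unit_cube y ->
       `|f x - f y| <= l * sup_dist x y) ->
    exists (w : nat) (cs : seq (gate R w d)),
      [/\ (0 < w)%N,
          (w <= C1 * d * (trunc_log 2 n).+1)%N,
          (circuit_depth cs <= C2 * d * n ^ d * (trunc_log 2 n).+1)%N,
          (num_params cs <= C3 * d * n ^ d)%N &
          forall x, in_unit_cube x ->
            `|f x - pqc_output cs x|
               <= eps + 2 * ((1 + l ^+ 2 / (n%:R * eps ^+ 2)) ^+ d - 1)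
            /\ `|f x - pqc_output cs x|
               <= eps + d%:R * 2 ^+ d * (l ^+ 2 / (n%:R * eps ^+ 2))].
Proof.
(* Width: [d t + 1 <= d (t + 1)]. Depth: 15 = 8 + 7, from the registers and the lookup. Parameters:
   one [d n^d] for each of these two parts. *)
exists 1%N, 15%N, 2%N => R d l f eps n d0 n0 eps0 fB fL.
(* [2^t <= n] controls the size, and [n < 2^(t+1)] gives [1 / 2^t <= 2 / n], the source of the
   factor 2 in the error. *)
set t := trunc_log 2 n.
have tn : (2 ^ t <= n)%N by apply: trunc_logP.
have nt : (n < 2 ^ t.+1)%N by apply: trunc_log_ltn.
have tdn : (2 ^ (d * t) <= n ^ d)%N by rewrite mulnC expnM leq_exp2r.
have nnd : (n <= n ^ d)%N by rewrite -{1}[n]expn1 leq_pexp2l.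
have tnd := leq_trans tn nnd.
exists (d * t).+1, (grid_circuit t (Ordinal d0) f); split => //.
- by rewrite mul1n mulnS; lia.
- apply: leq_trans (circuit_depth_size _) _; apply: leq_trans (size_grid_circuit _ _ _) _.
  have h1 : (d * t * (8 * 2 ^ t) <= d * t * (8 * n ^ d))%N by rewrite !leq_mul.
  have h2 : (n ^ d <= d * n ^ d)%N by rewrite leq_pmull.
  apply: (@leq_trans (d * t * (8 * n ^ d) + 7 * (d * n ^ d))); first by lia.
  by rewrite mulnS; set N := (n ^ d)%N; nia.
- apply: leq_trans (num_params_grid_circuit _ _ _) _.
  have h1 : (d * 2 ^ t <= d * n ^ d)%N by rewrite leq_mul.
  have h2 : (n ^ d <= d * n ^ d)%N by rewrite leq_pmull.
  lia.
move=> x xB; rewrite grid_circuit_output //.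
have e0 := grid_error eps0 fB fL t xB.
set a := l ^+ 2 / (n%:R * eps ^+ 2).
have nR : 0 < n%:R :> R by rewrite ltr0n.
have a0 : 0 <= a by rewrite divr_ge0 ?sqr_ge0 // mulr_ge0 ?sqr_ge0 // ltW.
have key : l ^+ 2 / eps ^+ 2 * (d%:R / 2 ^+ t) <= 2 * (d%:R * a).
  have -> : 2 * (d%:R * a) = l ^+ 2 / eps ^+ 2 * (d%:R * (2 / n%:R)).
    by rewrite /a; field; rewrite !gt_eqF.
  apply: ler_wpM2l; first by rewrite divr_ge0 ?sqr_ge0.
  apply: ler_wpM2l => //; rewrite ler_pdivlMr // mulrC ler_pdivrMr ?exprn_gt0 //.
  by rewrite -exprS -natrX ler_nat ltnW.
have da0 : 0 <= d%:R * a by rewrite mulr_ge0.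
split; apply: le_trans e0 _; rewrite lerD2l; apply: le_trans key _.
  (* First bound: [d a <= (1 + a)^d - 1]. *)
  by have := bernoulli_ineq d a0; lra.
(* The second bound also follows directly from [key], since [d > 0]. *)
have h : 2 <= 2 ^+ d :> R by rewrite -[leLHS]expr1 ler_eXn2l // ltr1n.
have := ler_wpM2r da0 h; lra.
Qed.
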